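(* Let $k\ge 1$ be an integer and let $0<c_1\le c_2$. There is a constant $C>0$, depending only on $k,c_1,c_2$ (and in particular independent of $q$), such that the following holds for every finite field $\mathbb F_q$. Let $P(x)\in\mathbb F_q[x_1,x_2,x_3]$ be a homogeneous polynomial of degree $k$ and let $H=\{x\in\mathbb F_q^3: P(x)=0\}$. Suppose that $c_1q^2\le |H|\le c_2q^2$ and that $H$ does not contain any plane passing through the origin. Then the extension estimate $R^*(2\to 4)\le C$ holds on $H$; that is, for every function $f:H\to\mathbb C$, $$\left(\sum_{m\in\mathbb F_q^3}\left|(f\,d\sigma)^\vee(m)\right|^4\right)^{1/4}\le C\left(\frac1{|H|}\sum_{x\in H}|f(x)|^2\right)^{1/2}.$$
   Context: $\mathbb F_q$ is the finite field with $q$ elements, and $|\cdot|$ of a finite set denotes its cardinality. $\chi$ denotes a fixed nontrivial additive character of $\mathbb F_q$, and $m\cdot x=m_1x_1+m_2x_2+m_3x_3$. A polynomial is homogeneous of degree $k$ if all its monomials with nonzero coefficients have total degree $k$. A plane passing through the origin is a set $\{x\in\mathbb F_q^3: m\cdot x=0\}$ with $m\in\mathbb F_q^3\setminus\{(0,0,0)\}$. $d\sigma$ is the normalized surface measure on $H$ (each point of $H$ has mass $1/|H|$), and for $f:H\to\mathbb C$ and $m\in\mathbb F_q^3$, $$(f\,d\sigma)^\vee(m)=\frac1{|H|}\sum_{x\in H}\chi(m\cdot x)f(x).$$ $R^*(p\to r)$ denotes the smallest constant such that $\|(f\,d\sigma)^\vee\|_{L^r(\mathbb F_q^3,dm)}\le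 R^*(p\to r)\|f\|_{L^p(H,d\sigma)}$ for all $f:H\to\mathbb C$, where $dm$ is the counting measure on $\mathbb F_q^3$. *)

(* Defs.v *)
From mathcomp Require Export all_boot all_order all_algebra.
From mathcomp Require Export classical_sets reals exp complex.
From mathcomp Require Export mpoly.

Set Implicit Arguments.
Unset Strict Implicit.
Unset Printing Implicit Defensive.

Import Order.TTheory GRing.Theory Num.Theory.
Local Open Scope ring_scope.

(* The complex numbers are R[i] for R : realType.  The absolute value `|z| of
   mathcomp lives in R[i]; normc z is the same number as an element of R. *)
Notation normc := Normc.normc.

Section Geometry.
Variable F : finFieldType.

Definition dot (m x : 'rV[F]_3) : F := \sum_i m 0 i * x 0 i.

Definition zero_set (P : {mpoly F[3]}) : {set 'rV[F]_3} :=
  [set x : 'rV[F]_3 | P.@[x 0] == 0].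

Definition plane0 (m : 'rV[F]_3) : {set 'rV[F]_3} :=
  [set x : 'rV[F]_3 | dot m x == 0].

Definition contains_plane0 (H : {set 'rV[F]_3}) : Prop :=
  exists2 m : 'rV[F]_3, m != 0 & plane0 m \subset H.

End Geometry.

Section Extension.
Variables (R : realType) (F : finFieldType).

Definition nontrivial_additive_character (chi : F -> R[i]) : Prop :=
  [/\ chi 0 = 1, forall a b, chi (a + b) = chi a * chi b
    & exists a, chi a != 1].

(* A function H -> C is given by a function on the whole space; only its
   values on H are used, here and in all definitions below. *)
Definition extension (chi : F -> R[i]) (H : {set 'rV[F]_3})
    (f : 'rV[F]_3 -> R[i]) (m : 'rV[F]_3) : R[i] :=
  #|H|%:R^-1 * \sum_(x in H) chi (dot m x) * f x.

Definition norm_dm (r : R) (g : 'rV[F]_3 -> R[i]) : R :=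
  (\sum_m normc (g m) `^ r) `^ r^-1.

Definition norm_dsigma (p : R) (H : {set 'rV[F]_3}) (f : 'rV[F]_3 -> R[i]) : R :=
  (#|H|%:R^-1 * \sum_(x in H) normc (f x) `^ p) `^ p^-1.

Definition extension_bound (chi : F -> R[i]) (H : {set 'rV[F]_3}) (p r A : R) :
    Prop :=
  forall f, norm_dm r (extension chi H f) <= A * norm_dsigma p H f.

(* The infimum is attained: see Rstar_smallest. *)
Definition Rstar (chi : F -> R[i]) (H : {set 'rV[F]_3}) (p r : R) : R :=
  inf [set A : R | 0 <= A /\ extension_bound chi H p r A].

Lemma Rstar_le chi H p r A :
  0 <= A -> extension_bound chi H p r A -> Rstar chi H p r <= A.
Proof.
move=> A0 bA; apply: ge_inf; last by split.
by exists 0 => B [].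
Qed.

Lemma Rstar_smallest chi H p r A :
  0 <= A -> extension_bound chi H p r A ->
  extension_bound chi H p r (Rstar chi H p r).
Proof.
move=> A0 bA f; set N := norm_dsigma p H f; set L := norm_dm r _.
have N0 : 0 <= N by apply: powR_ge0.
have neS : nonempty [set B : R | 0 <= B /\ extension_bound chi H p r B].
  by exists A; split.
have [NE|Nneq] := eqVneq N 0.
  by have := bA f; rewrite -/N NE !mulr0.
have Np : 0 < N by rewrite lt_neqAle eq_sym Nneq.
rewrite -ler_pdivrMr //; apply: lb_le_inf => // B [_ /(_ f)].
by rewrite -/N -/L ler_pdivrMr.
Qed.

End Extension.

(* Main.v *)
Require Import Defs.
From mathcomp Require Import all_boot all_order all_algebra.
From mathcomp Require Import classical_sets reals exp complex.
From mathcomp Require Import mpoly.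
From mathcomp Require Import ring.

Set Implicit Arguments.
Unset Strict Implicit.
Unset Printing Implicit Defensive.

Import Order.TTheory GRing.Theory Num.Theory.
Local Open Scope ring_scope.

(** Expanding the fourth power and using Parseval turns the estimate into a
    bound for the additive energy: for g equal to f on H and to 0 elsewhere,
    the sum over m of the fourth power of the modulus of the extension is
    q^3 / |H|^4 times the sum over u of |(g * g)(u)|^2 ([sqr_fourier],
    [parseval]).  By Cauchy-Schwarz the terms with u != 0 contribute at most
    N (sum |f|^2)^2, where N bounds the number of representations of a nonzero
    u as a sum of two points of H, and the term u = 0 contributes at most
    (sum |f|^2)^2 ([energy_le]).  As |H| is at least c1 q^2, it remains to see
    that N can be taken of order q + |H| / q.

    This count ([card_sums]) rests on homogeneity.  For q <= k + 1 it is
    trivial; let q > k + 1.  If x and u - x are in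
    H, then so are c x and c x - c u for all c != 0.  Hence each representation
    with x off the line F u yields q - 1 pairs (v, a), a != 0, with v and
    v + a u both in H, and v off F u; different representations yield different
    pairs.  Conversely, for v off the line F u, the polynomial
    a |-> P(v + a u) has at most k roots: with more roots it would vanish
    identically, and by homogeneity H would contain the plane spanned by u
    and v ([zero_set_line_card]).  So (q - 1) N' <= k |H|, where N' counts the
    representations with x off F u; those with x on F u are at most q. *)

(** * Homogeneous polynomials on lines and planes *)

Section Cone.
Variables (F : finFieldType) (k : nat) (P : {mpoly F[3]}).
Hypothesis homP : P \is k.-homog.
Local Notation H := (zero_set P).

Lemma meval_homogZ c (x : 'rV[F]_3) :
  P.@[(c *: x) 0] = c ^+ k * P.@[x 0].
Proof.
rewrite !mevalE mulr_sumr; apply: eq_big_seq => m mP.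
rewrite mulrCA; congr (_ * _).
have <- : mdeg m = k by exact: (dhomogP _ _ _ homP m mP).
rewrite mdegE -prodrXr -big_split /=.
by apply: eq_bigr => i _; rewrite mxE exprMn.
Qed.

Lemma zero_setZ c (x : 'rV[F]_3) : c != 0 -> (c *: x \in H) = (x \in H).
Proof.
by move=> c0; rewrite !inE meval_homogZ mulf_eq0 expf_eq0 (negbTE c0) andbF.
Qed.

(** A homogeneous polynomial of degree k has degree at most k along any line,
    so more than k zeros on a line force it to vanish on the whole line. *)
Lemma zero_set_line (v w : 'rV[F]_3) (c : F) :
  (k < #|[set a | (v + a *: w)%R \in H]|)%N -> v + c *: w \in H.
Proof.
(* Q is the restriction of P to the line v + 'X w. *)
pose Q := \sum_(m <- msupp P)
  P@_m *: \prod_i ((v 0 i)%:P + w 0 i *: 'X) ^+ m i.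
have QE a : Q.[a] = P.@[(v + a *: w) 0].
  rewrite /Q mevalE horner_sum; apply: eq_bigr => m _.
  rewrite hornerZ horner_prod; congr (_ * _); apply: eq_bigr => i _.
  by rewrite horner_exp !hornerE !mxE mulrC.
have szQ : (size Q <= k.+1)%N.
  apply: (leq_trans (size_sum _ _ _)); apply/bigmax_leqP_seq => m mP _.
  apply: (leq_trans (size_scale_leq _ _)).
  have <- : mdeg m = k by exact: (dhomogP _ _ _ homP m mP).
  rewrite mdegE.
  elim/big_rec2: _ => [|i n q _ szq]; first by rewrite size_poly1.
  apply: (leq_trans (size_polyMleq _ _)).
  have szl : (size ((v 0 i)%:P + w 0 i *: 'X)%R <= 2)%N.
    rewrite (leq_trans (size_polyD _ _)) // geq_max.
    rewrite (leq_trans (size_polyC_leq1 _)) //=.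
    by rewrite (leq_trans (size_scale_leq _ _)) // size_polyX.
  have szX := size_poly_exp_leq ((v 0 i)%:P + w 0 i *: 'X) (m i).
  have szm : (size (((v 0 i)%:P + w 0 i *: 'X) ^+ m i)%R <= (m i).+1)%N.
    rewrite (leq_trans szX) // ltnS -[leqRHS]mul1n leq_mul2r -subn1.
    by rewrite leq_subLR szl orbT.
  by rewrite -subn1 leq_subLR (leq_trans (leq_add szm szq)) // addnS.
move=> ltk; suff Q0 : Q = 0 by rewrite inE -QE Q0 horner0.
apply/eqP; apply: contraLR ltk => Q0; rewrite -leqNgt -ltnS.
apply: leq_trans szQ; rewrite cardE.
apply: max_poly_roots (enum_uniq _) => //.
by apply/allP => a; rewrite mem_enum !inE /root QE.
Qed.

Lemma mxrank_adds_indep (v w : 'rV[F]_3) :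
  w != 0 -> ~~ (v <= w)%MS -> \rank (w + v)%MS = 2%N.
Proof.
move=> w0 vw; apply/eqP; rewrite eqn_leq; apply/andP; split.
  rewrite (leq_trans (mxrank_adds_leqif _ _)) // !rank_rV.
  by case: (w != 0) (v != 0) => [] [].
have : (w < w + v)%MS.
  by rewrite ltmxE addsmxSl /= addsmx_sub submx_refl.
by rewrite ltmxErank rank_rV w0 => /andP[].
Qed.

Lemma dot_mx (m x : 'rV[F]_3) : dot m x = (x *m m^T) 0 0.
Proof. by rewrite mxE; apply: eq_bigr => i _; rewrite mxE mulrC. Qed.

(** Two independent vectors span a plane through the origin. *)
Lemma plane0_span (v w : 'rV[F]_3) : w != 0 -> ~~ (v <= w)%MS ->
  exists2 m : 'rV[F]_3, m != 0 & forall x, x \in plane0 m ->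
    exists s t, x = s *: v + t *: w.
Proof.
move=> w0 vw; have rk := mxrank_adds_indep w0 vw.
have : kermx (w + v)%MS^T != 0.
  by rewrite -mxrank_eq0 mxrank_ker mxrank_tr rk.
case/rowV0Pn => m /sub_kermxP mA m0; exists m => // x.
have Am : (w + v <= kermx m^T)%MS.
  by apply/sub_kermxP; rewrite -[LHS]trmxK trmx_mul trmxK mA trmx0.
rewrite inE dot_mx => /eqP xm.
have xA : (x <= w + v)%MS.
  have rkm : \rank (kermx m^T) = 2%N by rewrite mxrank_ker mxrank_tr rank_rV m0.
  have := mxrank_leqif_sup Am; rewrite rkm rk => /leqif_refl Am'.
  apply: submx_trans Am'; apply/sub_kermxP.
  by apply/matrixP => i j; rewrite !ord1 xm mxE.
have [[a b] /= ->] := sub_addsmxP xA; exists (b 0 0), (a 0 0).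
by rewrite {1}[a]mx11_scalar {1}[b]mx11_scalar !mul_scalar_mx addrC.
Qed.

Hypothesis noplane : ~ contains_plane0 H.

(** The hypothesis on the size of F makes the line of direction v through
    t w, minus the point t w itself, contain more than k points, which gives
    the part of the plane on the line spanned by w. *)
Lemma zero_set_line_card (v w : 'rV[F]_3) : (k.+1 < #|F|)%N ->
    w != 0 -> ~~ (v <= w)%MS ->
  (#|[set a | (v + a *: w)%R \in H]| <= k)%N.
Proof.
move=> kq w0 vw; rewrite leqNgt; apply/negP => lt_k; apply: noplane.
have [m m0 sp] := plane0_span w0 vw; exists m => //.
have HA (s t : F) : s != 0 -> s *: v + t *: w \in H.
  move=> s0; have -> : s *: v + t *: w = s *: (v + (s^-1 * t) *: w).
    by rewrite scalerDr scalerA mulVKf.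
  by rewrite zero_setZ // zero_set_line.
apply/fintype.subsetP => x /sp[s [t ->]]; have [-> | s0] := eqVneq s 0; last exact: HA.
rewrite addrC; apply: zero_set_line.
rewrite (leq_trans _ (subset_leq_card (_ : [set~ 0] \subset _))) //.
  by rewrite cardsC1 -ltnS prednK // (leq_ltn_trans _ kq).
by apply/fintype.subsetP => a; rewrite !inE => a0; rewrite addrC; have := HA a t a0; rewrite inE.
Qed.

(** The representations of u as a sum of two points of H, given by their first
    summand. *)
Definition sums (u : 'rV[F]_3) := [set x in H | u - x \in H].

(** The representations of u by x off the line spanned by u, each dilated by
    the nonzero scalars, inject into the pairs v, v + a u of points of H with v
    off that line. *)
Lemma card_sums_off_line u : (k.+1 < #|F|)%N -> u != 0 ->
  (#|F|.-1 * #|[set x in sums u | ~~ (x <= u)%MS]| <= k * #|H|)%N.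
Proof.
move=> kq u0; set S := [set x in _ | _].
(* A pair (v, a) of T stands for the two points v and v + a u of H. *)
pose T := [set p : 'rV[F]_3 * F |
  [&& p.1 \in H, ~~ (p.1 <= u)%MS & p.1 + p.2 *: u \in H]].
have leT : (#|T| <= k * #|H|)%N.
  have -> : #|T| = (\sum_(x in H | ~~ (x <= u)%MS)
                      \sum_(a | (x + a *: u)%R \in H) 1)%N.
    by rewrite pair_big_dep sum1dep_card; apply: eq_card => p; rewrite !inE andbA.
  rewrite -[leqRHS]mulnC -sum_nat_const big_mkcondr; apply: leq_sum => x _.
  case: ifP => // xu; rewrite sum1dep_card.
  exact: zero_set_line_card.
apply: leq_trans leT.
rewrite mulnC -(cardsC1 (0 : F)) -cardsX.
pose h (p : 'rV[F]_3 * F) := (p.2 *: p.1, - p.2).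
have injh : {in finset.setX S [set~ 0] &, injective h}.
  move=> [x c] [y d]; rewrite !inE /= => /andP[_ c0] _ [+ /oppr_inj cd].
  by rewrite -cd => /(scalerI c0) ->.
rewrite -(card_in_imset injh).
  apply/subset_leq_card/fintype.subsetP => _ /imsetP[[x c] + ->].
rewrite !inE /= => /andP[/andP[/andP[xH uxH] xu] c0].
  have := zero_setZ x c0; rewrite !inE => ->; rewrite xH /=.
  rewrite eqmx_scale // xu /=.
  have -> : c *: x + - c *: u = (- c) *: (u - x).
    by rewrite scalerBr !scaleNr opprK addrC.
  by have := @zero_setZ (- c) (u - x); rewrite oppr_eq0 => /(_ c0); rewrite !inE => ->.
Qed.

Lemma card_line (u : 'rV[F]_3) : (#|[set x : 'rV[F]_3 | (x <= u)%MS]| <= #|F|)%N.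
Proof.
apply: (leq_trans _ (leq_imset_card (fun a : F => a *: u) predT)).
apply/subset_leq_card/fintype.subsetP => x; rewrite inE => /sub_rVP[a ->].
exact: imset_f.
Qed.

Lemma card_sums u : (0 < k)%N -> u != 0 ->
  (#|F| * #|sums u| <= #|F| ^ 2 + 2 * (k * #|H|))%N.
Proof.
move=> k0 u0; have [kq|qk] := ltnP k.+1 #|F|; last first.
  (* For q <= k + 1 <= 2 k the trivial bound of the count by |H| suffices. *)
  rewrite (leq_trans _ (leq_addl _ _)) // mulnA leq_mul //.
    by rewrite (leq_trans qk) // mul2n -addnn -addn1 leq_add2l.
  by apply/subset_leq_card/fintype.subsetP => x; rewrite inE => /andP[].
have q1 : (1 < #|F|)%N by apply: leq_ltn_trans kq.
have q2 : (#|F| <= 2 * #|F|.-1)%N.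
  by rewrite -(prednK (ltnW q1)) /= mul2n -addnn -addn1 leq_add2l -subn1 subn_gt0.
rewrite -(cardsID [set x : 'rV[F]_3 | (x <= u)%MS] (sums u)) mulnDr leq_add //.
  rewrite -mulnn leq_mul2l (leq_trans _ (card_line u)) ?orbT //.
  exact/subset_leq_card/finset.subsetIr.
apply: leq_trans (leq_mul q2 (leqnn _)) _; rewrite -mulnA leq_mul2l /=.
apply: leq_trans (card_sums_off_line kq u0); rewrite leq_mul2l.
apply/orP; right; apply/subset_leq_card/fintype.subsetP => x.
by rewrite !inE andbC.
Qed.

End Cone.

(** * Additive energy *)

Section Energy.
Variables (C : numClosedFieldType) (V : finZmodType).
Implicit Types f : V -> C.

(** The self-convolution f * f at u. *)
Definition conv f u := \sum_x f x * f (u - x).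

Lemma sum_sqr_le (S : {set V}) (a : V -> C) :
  `|\sum_(x in S) a x| ^+ 2 <= #|S|%:R * \sum_(x in S) `|a x| ^+ 2.
Proof.
have : `|\sum_(x in S) a x| ^+ 2 <= (\sum_(x in S) `|a x|) ^+ 2.
  by rewrite ler_pXn2r ?nnegrE ?sumr_ge0 ?ler_norm_sum.
move=> /le_trans; apply; rewrite -(ler_pMn2r (isT : (0 < 2)%N)).
have -> : #|S|%:R * (\sum_(x in S) `|a x| ^+ 2) *+ 2 =
    \sum_(x in S) \sum_(y in S) (`|a x| ^+ 2 + `|a y| ^+ 2).
  under [RHS]eq_bigr do rewrite big_split /= sumr_const.
  by rewrite big_split /= sumr_const sumrMnl mulr_natl mulr2n.
rewrite expr2 mulr_suml -sumrMnl; apply: ler_sum => x _.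
rewrite mulr_sumr -sumrMnl; apply: ler_sum => y _.
by rewrite real_leif_mean_square_scaled ?normr_real.
Qed.

(** If every nonzero u is a sum of two points of S in at most N ways, the
    additive energy of f supported on S is at most N + 1 times the square of
    its squared l^2 norm. *)
Lemma energy_le (S : {set V}) f (N : C) :
    (forall x, x \notin S -> f x = 0) -> 0 <= N ->
    (forall u, u != 0 -> #|[set x in S | u - x \in S]|%:R <= N) ->
  \sum_u `|conv f u| ^+ 2 <= (N + 1) * (\sum_x `|f x| ^+ 2) ^+ 2.
Proof.
move=> fS N0 leN; set A := \sum_x `|f x| ^+ 2.
have A0 : 0 <= A by apply: sumr_ge0 => x _; apply: exprn_ge0.
rewrite (bigD1 0) //= mulrDl mul1r addrC lerD //; last first.
  (* u = 0: bound |f x| |f (- x)| by the mean of the squares. *)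
  rewrite ler_pXn2r ?nnegrE // -(ler_pMn2r (isT : (0 < 2)%N)).
  have -> : A *+ 2 = \sum_x (`|f x| ^+ 2 + `|f (0 - x)| ^+ 2).
    rewrite big_split mulr2n /=; congr (_ + _).
    rewrite /A (reindex_inj (h := fun x => 0 - x)) //.
    by move=> x y /=; rewrite !sub0r => /oppr_inj.
  apply: (@le_trans _ _ ((\sum_x `|f x * f (0 - x)|) *+ 2)).
    by rewrite lerMn2r ler_norm_sum.
  rewrite -sumrMnl; apply: ler_sum => x _; rewrite normrM.
  by rewrite real_leif_mean_square_scaled ?normr_real.
apply: (@le_trans _ _ (\sum_(u | u != 0) N * \sum_x `|f x * f (u - x)| ^+ 2)).
  apply: ler_sum => u u0; set T := [set x in S | u - x \in S].
  have -> : conv f u = \sum_(x in T) f x * f (u - x).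
    rewrite /conv (bigID (mem T)) /= [X in _ + X]big1 ?addr0 // => x.
    rewrite !inE negb_and => /orP[/fS ->|/fS ->]; first by rewrite mul0r.
    by rewrite mulr0.
  apply: (le_trans (sum_sqr_le _ _)).
  apply: ler_pM (leN u u0) _ => //; first by rewrite sumr_ge0 // => x _; exact: exprn_ge0.
  by rewrite [leRHS](bigID (mem T)) /= lerDl sumr_ge0 // => x _; exact: exprn_ge0.
rewrite -mulr_sumr ler_wpM2l //.
have -> : A ^+ 2 = \sum_u \sum_x `|f x * f (u - x)| ^+ 2.
  rewrite exchange_big expr2 mulr_suml; apply: eq_bigr => x _ /=.
  rewrite mulr_sumr (reindex_inj (addIr (- x))) /=.
  by apply: eq_bigr => u _; rewrite normrM exprMn.
rewrite [leRHS](bigD1 0) //= lerDr sumr_ge0 // => x _; exact: exprn_ge0.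
Qed.

End Energy.

(** * Fourier analysis on F^3 *)

Section Character.
Variables (C : numClosedFieldType) (F : finFieldType) (chi : F -> C).
Hypotheses (chi0 : chi 0 = 1) (chiD : forall a b, chi (a + b) = chi a * chi b).
Hypothesis chi_nt : exists a, chi a != 1.

Lemma chi_norm a : `|chi a| = 1.
Proof.
have chiX n : chi (a *+ n) = chi a ^+ n.
  by elim: n => [|n IHn]; rewrite ?chi0 // mulrS exprS chiD IHn.
have aq : a *+ #|F| = 0.
  (* Translation by a permutes F, so it preserves the sum of all elements. *)
  have : \sum_(b : F) b = \sum_(b : F) (b + a).
    exact: (reindex_inj (addIr a)).
  rewrite big_split sumr_const /= => /eqP.
  by rewrite -[eqbLHS]addr0 (inj_eq (addrI _)) => /eqP <-.
have := chiX #|F|; rewrite aq chi0 => /(congr1 Num.norm).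
rewrite normr1 normrX => /esym/eqP.
have q0 : (0 < #|F|)%N by apply/card_gt0P; exists 0.
by rewrite pexpr_eq1 // => /eqP.
Qed.

Lemma chi_conj a : (chi a)^* = chi (- a).
Proof.
have nz : chi a != 0 by rewrite -normr_gt0 chi_norm ltr01.
by apply: (mulfI nz); rewrite -normCK chi_norm expr1n -chiD subrr chi0.
Qed.

Lemma dotDl (m n x : 'rV[F]_3) : dot (m + n) x = dot m x + dot n x.
Proof. by rewrite -big_split; apply: eq_bigr => i _; rewrite mxE mulrDl. Qed.

Lemma dotC (m x : 'rV[F]_3) : dot m x = dot x m.
Proof. by apply: eq_bigr => i _; rewrite mulrC. Qed.

Lemma dotDr (m x y : 'rV[F]_3) : dot m (x + y) = dot m x + dot m y.
Proof. by rewrite dotC dotDl !(dotC m). Qed.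

Lemma dotNr (m x : 'rV[F]_3) : dot m (- x) = - dot m x.
Proof. by rewrite -sumrN; apply: eq_bigr => i _; rewrite mxE mulrN. Qed.

Lemma sum_chi_dot u :
  \sum_m chi (dot m u) = if u == 0 then (#|F| ^ 3)%:R else 0.
Proof.
have [-> | u0] := eqVneq u 0.
  have dot0 m : dot m 0 = 0.
    by rewrite /dot big1 // => i _; rewrite mxE mulr0.
  under eq_bigr do rewrite dot0 chi0.
  by rewrite sumr_const card_mx mul1n.
have [a chia] := chi_nt; have /rV0Pn[i ui] := u0.
(* Translating m by m0 multiplies the sum by chi a != 1. *)
pose m0 : 'rV[F]_3 := (a / u 0 i) *: delta_mx 0 i.
have dm0 : dot m0 u = a.
  rewrite /dot (bigD1 i) //= big1 => [|j ji]; last first.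
    by rewrite !mxE eqxx (negbTE ji) mulr0 mul0r.
  by rewrite !mxE !eqxx mulr1 addr0 divfK.
apply/eqP; have : (chi a - 1) * \sum_m chi (dot m u) == 0.
  rewrite mulrBl mul1r subr_eq0 mulr_sumr [eqbRHS](reindex_inj (addrI m0)).
  by apply/eqP; apply: eq_bigr => m _; rewrite dotDl dm0 chiD.
by rewrite mulf_eq0 subr_eq0 (negbTE chia).
Qed.

Lemma parseval (G : 'rV[F]_3 -> C) :
  \sum_m `|\sum_u chi (dot m u) * G u| ^+ 2 = (#|F| ^ 3)%:R * \sum_u `|G u| ^+ 2.
Proof.
have E m : `|\sum_u chi (dot m u) * G u| ^+ 2 =
    \sum_u \sum_w G u * (G w)^* * chi (dot m (u - w)).
  rewrite normCK rmorph_sum mulr_suml; apply: eq_bigr => u _.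
  rewrite mulr_sumr; apply: eq_bigr => w _.
  by rewrite rmorphM /= chi_conj dotDr dotNr chiD mulrACA mulrC.
under eq_bigr do rewrite E.
rewrite exchange_big mulr_sumr; apply: eq_bigr => u _.
rewrite exchange_big (bigD1 u) //= -mulr_sumr sum_chi_dot subrr eqxx -normCK mulrC.
rewrite [X in _ + X]big1 ?addr0 // => w wu.
by rewrite -mulr_sumr sum_chi_dot subr_eq0 eq_sym (negbTE wu) mulr0.
Qed.

(** The square of a Fourier transform is the transform of the convolution. *)
Lemma sqr_fourier (f : 'rV[F]_3 -> C) m :
  (\sum_x chi (dot m x) * f x) ^+ 2 = \sum_u chi (dot m u) * conv f u.
Proof.
under [RHS]eq_bigr do rewrite mulr_sumr.
rewrite exchange_big expr2 mulr_suml; apply: eq_bigr => x _ /=.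
rewrite mulr_sumr (reindex_inj (addIr (- x))) /=.
apply: eq_bigr => u _; rewrite mulrACA -chiD -dotDr.
by rewrite addrC subrK.
Qed.

End Character.

(** * The extension estimate *)

Section L2L4.
Variables (R : realType) (k : nat).
Variables (F : finFieldType) (chi : F -> R[i]) (P : {mpoly F[3]}).
Hypotheses (k0 : (0 < k)%N) (chiP : nontrivial_additive_character chi).
Hypotheses (homP : P \is k.-homog) (noplane : ~ contains_plane0 (zero_set P)).
Local Notation H := (zero_set P).
Local Notation q := #|F|.
Local Notation h := #|H|.

(** The estimate with an explicit constant in terms of q, k and |H|. *)
Lemma extension_L4 f :
  \sum_m `|extension chi H f m| ^+ 4 <=
  h%:R ^- 4 * (q ^ 2 * (2 * q ^ 2 + 2 * (k * h)))%:R *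
    (\sum_(x in H) `|f x| ^+ 2) ^+ 2.
Proof.
case: chiP => chi0 chiD chi_nt.
have q0 : (0 < q)%N by apply/card_gt0P; exists 0.
pose g x := if x \in H then f x else 0.
have gE : \sum_(x in H) `|f x| ^+ 2 = \sum_x `|g x| ^+ 2.
  rewrite big_mkcond; apply: eq_bigr => x _; rewrite /g.
  by case: ifP => // _; rewrite normr0 expr0n.
have EE m : `|extension chi H f m| ^+ 4 =
    h%:R ^- 4 * `|\sum_u chi (dot m u) * conv g u| ^+ 2.
  have -> : extension chi H f m = h%:R^-1 * \sum_x chi (dot m x) * g x.
    rewrite /extension big_mkcond; congr (_ * _); apply: eq_bigr => x _.
    by rewrite /g; case: ifP => // _; rewrite mulr0.
  rewrite normrM exprMn normfV normr_nat exprVn; congr (_ * _).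
  by rewrite (exprM _ 2 2) -normrX sqr_fourier.
under eq_bigr do rewrite EE.
rewrite -mulr_sumr (parseval chi0 chiD chi_nt) -mulrA.
rewrite ler_wpM2l ?invr_ge0 ?exprn_ge0 // gE.
(* By card_sums, q N bounds q times the number of representations. *)
pose N : R[i] := (q ^ 2 + 2 * (k * h))%:R / q%:R.
have qC0 : q%:R != 0 :> R[i] by rewrite pnatr_eq0 -lt0n.
have leN := @energy_le _ _ H g N.
have -> : (q ^ 2 * (2 * q ^ 2 + 2 * (k * h)))%:R *
    (\sum_x `|g x| ^+ 2) ^+ 2 =
    (q ^ 3)%:R * ((N + q%:R) * (\sum_x `|g x| ^+ 2) ^+ 2).
  rewrite mulrA; congr (_ * _).
  by rewrite /N !(natrM, natrD, natrX); field.
rewrite ler_wpM2l //; apply: le_trans (leN _ _ _) _.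
- by move=> x xH; rewrite /g (negbTE xH).
- by rewrite divr_ge0.
- move=> u u0; rewrite ler_pdivlMr ?ltr0n // -natrM ler_nat mulnC.
  exact: card_sums.
rewrite ler_wpM2r ?exprn_ge0 ?sumr_ge0 // => [x _|].
  exact: exprn_ge0.
by rewrite lerD2l ler1n.
Qed.

(** The same inequality between real numbers. *)
Lemma extension_L4_real f :
  \sum_m normc (extension chi H f m) ^+ 4 <=
  h%:R ^- 4 * (q ^ 2 * (2 * q ^ 2 + 2 * (k * h)))%:R *
    (\sum_(x in H) normc (f x) ^+ 2) ^+ 2.
Proof.
have sumE (S : pred 'rV[F]_3) g n :
    (\sum_(x | S x) normc (g x) ^+ n)%:C%C = \sum_(x | S x) `|g x| ^+ n :> R[i].
  by rewrite rmorph_sum; apply: eq_bigr => x _; rewrite rmorphXn.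
rewrite -lecR (sumE xpredT) rmorphM rmorphXn /= (sumE (fun x => x \in H)) rmorphM fmorphV rmorphXn.
by rewrite !rmorph_nat; exact: extension_L4.
Qed.

End L2L4.

Theorem theorem4p1 (R : realType) (k : nat) (c1 c2 : R) :
  (1 <= k)%N -> 0 < c1 -> c1 <= c2 ->
  exists2 C : R, 0 < C &
  forall (F : finFieldType) (chi : F -> R[i]) (P : {mpoly F[3]}),
    nontrivial_additive_character chi ->
    P \is k.-homog ->
    c1 * #|F|%:R ^+ 2 <= #|zero_set P|%:R ->
    #|zero_set P|%:R <= c2 * #|F|%:R ^+ 2 ->
    ~ contains_plane0 (zero_set P) ->
    Rstar chi (zero_set P) 2 4 <= C /\
    forall f : 'rV[F]_3 -> R[i],
      (\sum_(m : 'rV[F]_3) normc (extension chi (zero_set P) f m) ^+ 4) `^ (1 / 4)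
      <= C * (1 / #|zero_set P|%:R *
              \sum_(x in zero_set P) normc (f x) ^+ 2) `^ (1 / 2).
Proof.
(* K = q^2 (2 q^2 + 2 k h) / h^2 after replacing q^2 by its bound h / c1. *)
move=> k0 c10 _; pose K := 2 / c1 ^+ 2 + (2 * k)%:R / c1.
have K0 : 0 < K.
  by rewrite ltr_wpDr ?divr_ge0 ?divr_gt0 ?exprn_gt0 // ltW.
exists (K `^ (1 / 4)); first exact: powR_gt0.
move=> F chi P chiP homP leH _ noplane; set H := zero_set P in leH *.
set C := K `^ _.
have C0 : 0 <= C by apply: powR_ge0.
have nc0 z : 0 <= normc z :> R by case: z => a b; apply: sqrtr_ge0.
have main f : (\sum_m normc (extension chi H f m) ^+ 4) `^ (1 / 4) <=
    C * (1 / #|H|%:R * \sum_(x in H) normc (f x) ^+ 2) `^ (1 / 2).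
  set A := \sum_(x in H) _; set L := \sum_m _; set h : R := #|H|%:R in leH *.
  have A0 : 0 <= A by apply: sumr_ge0 => x _; apply: exprn_ge0.
  have L0 : 0 <= L by apply: sumr_ge0 => x _; apply: exprn_ge0.
  have q0 : 0 < #|F|%:R :> R by rewrite ltr0n; apply/card_gt0P; exists 0.
  have h0 : 0 < h by apply: lt_le_trans leH; rewrite mulr_gt0 ?exprn_gt0.
  have LK : L <= K * (1 / h * A) ^+ 2.
    apply: (le_trans (extension_L4_real k0 chiP homP noplane f)).
    rewrite -/H -/h -/A div1r exprMn [leRHS]mulrA ler_wpM2r ?exprn_ge0 //.
    rewrite mulrC exprVn -ler_pdivlMr ?invr_gt0 ?exprn_gt0 // invrK.
    have -> : K * h ^- 2 * h ^+ 4 = K * h ^+ 2.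
      by rewrite -mulrA; congr (_ * _); field; rewrite gt_eqF.
    have qh : #|F|%:R ^+ 2 <= h / c1 by rewrite ler_pdivlMr // mulrC.
    have -> : K * h ^+ 2 = (h / c1) * (2 * (h / c1) + 2 * (k%:R * h)).
      by rewrite /K natrM; field; rewrite gt_eqF.
    rewrite !(natrM, natrX, natrD) -/h.
    have q20 : 0 <= #|F|%:R ^+ 2 :> R by apply: exprn_ge0.
    apply: ler_pM => //.
      by rewrite addr_ge0 // !mulr_ge0 // ltW.
    by rewrite lerD2r ler_wpM2l.
  apply: (@le_trans _ _ ((K * (1 / h * A) ^+ 2) `^ (1 / 4))).
    by apply: ge0_ler_powR; rewrite ?nnegrE ?divr_ge0 ?(le_trans L0 LK).
  have B0 : 0 <= 1 / h * A by rewrite mulr_ge0 // divr_ge0 // ltW.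
  rewrite powRM ?exprn_ge0 ?(ltW K0) // -powR_mulrn // -powRrM.
  by have -> : 2%:R * (1 / 4) = 1 / 2 :> R by field.
split; last exact: main.
have sumE (S : pred 'rV[F]_3) g n :
    \sum_(x | S x) normc (g x) `^ n%:R = \sum_(x | S x) normc (g x) ^+ n :> R.
  by apply: eq_bigr => x _; rewrite powR_mulrn.
apply: Rstar_le C0 _ => f; rewrite /norm_dm /norm_dsigma.
rewrite (sumE xpredT _ 4) (sumE (fun x => x \in H) _ 2).
by have := main f; rewrite !div1r.
Qed.
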